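(* For $n\ge 2$, the number of minimum dominating sets of the path $P_n$ is $$\tau(P_n)=\begin{cases}1 & \text{if } n\equiv 0\pmod 3,\\ n+\frac12\lfloor\frac n3\rfloor\left(\lfloor \frac n3\rfloor -1\right) & \text{if } n\equiv 1\pmod 3,\\ 2+\lfloor\frac n3\rfloor & \text{if } n\equiv 2\pmod 3.\end{cases}$$
   Context: All graphs are finite, simple and undirected; $P_n$ is the path on $n$ vertices. A set $D\subseteq V(G)$ is a dominating set of $G$ if every vertex not in $D$ is adjacent to at least one vertex of $D$. The domination number $\gamma(G)$ is the minimum cardinality of a dominating set; a dominating set of cardinality $\gamma(G)$ is a $\gamma(G)$-set. $\tau(G)$ denotes the total number of $\gamma(G)$-sets. *)

(* Defs.v *)
From mathcomp Require Import all_boot.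

Set Implicit Arguments.
Unset Strict Implicit.
Unset Printing Implicit Defensive.

Record sgraph := SGraph {
  vertex :> finType;
  adj : rel vertex;
  adj_sym : symmetric adj;
  adj_irr : irreflexive adj }.

Section Domination.
Variable G : sgraph.
Implicit Type D : {set G}.

Definition dominating D : bool :=
  [forall v : G, (v \notin D) ==> [exists u in D, adj v u]].

Lemma dominating_setT : dominating [set: G].
Proof. by apply/forallP => v; rewrite inE. Qed.

Definition domination_number : nat :=
  #|[arg min_(D < [set: G] | dominating D) #|D| ]|.

(* The default [set: G] in the arg min is harmless, as it is dominating. *)
Lemma domination_numberP :
  (exists2 D, dominating D & #|D| = domination_number) /\
  (forall D, dominating D -> domination_number <= #|D|).
Proof.
rewrite /domination_number; case: arg_minnP => [|D domD minD].
  exact: dominating_setT.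
by split; first by exists D.
Qed.

Definition gamma_set D : bool := dominating D && (#|D| == domination_number).

Definition tau : nat := #|[set D : {set G} | gamma_set D]|.

End Domination.

Definition path_adj (n : nat) : rel 'I_n :=
  fun i j => (i.+1 == j :> nat) || (j.+1 == i :> nat).

Lemma path_adj_sym n : symmetric (@path_adj n).
Proof. by move=> i j; rewrite /path_adj orbC. Qed.

Lemma path_adj_irr n : irreflexive (@path_adj n).
Proof. by move=> i; rewrite /path_adj orbb gtn_eqF. Qed.

Definition path_graph (n : nat) : sgraph :=
  SGraph (@path_adj_sym n) (@path_adj_irr n).

(* Main.v *)
(** Reading a path from left to right, a vertex set is a word of bits, and
domination is checked by a three-state automaton: the last vertex is chosen,
not chosen but dominated, or not yet dominated. With [k] chosen vertices still
to come, these states can handle at most [3k+1], [3k] and [3k-1] further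
vertices, so the transitions give recurrences for the number of accepted words
whose length falls short of the maximum by 0, 1 or 2. These recurrences are
solved by 1, a linear and a quadratic polynomial in [k] respectively. *)
Require Import Defs.
From mathcomp Require Import all_boot.
From mathcomp Require Import zify.

Set Implicit Arguments.
Unset Strict Implicit.
Unset Printing Implicit Defensive.

Definition card_dominating (G : sgraph) (k : nat) : nat :=
  #|[set D : {set G} | dominating D && (#|D| == k)]|.

(** The domination number need not be computed beforehand: it is the first size at which the count
    is nonzero. *)
Lemma tau_card_dominating (G : sgraph) (k : nat) :
  0 < card_dominating G k -> (forall j, j < k -> card_dominating G j = 0) ->
  tau G = card_dominating G k.
Proof.
case/card_gt0P=> D; rewrite inE => /andP[domD /eqP cardD] min_k.
have [[E domE cardE] gamma_min] := domination_numberP G.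
have le_gamma : domination_number G <= k by rewrite -cardD gamma_min.
suff gammaE : domination_number G = k by rewrite /tau /gamma_set gammaE.
apply/eqP; rewrite eqn_leq le_gamma leqNgt; apply/negP=> /min_k /eqP.
by rewrite cards_eq0 => /eqP/setP/(_ E); rewrite !inE domE cardE eqxx.
Qed.

(* [p]: the previous vertex is chosen; [need]: the previous vertex is not yet
   dominated. *)
Fixpoint dom_word (p need : bool) (s : seq bool) : bool :=
  if s is b :: s' then (need ==> b) && dom_word b (~~ (p || b)) s' else ~~ need.

(** Prepending [p] shifts the word by one, so index [i] of [p :: s] is the left neighbour of vertex
    [i]. The default [false] acts as an unchosen vertex beyond the right end. *)
Lemma dom_wordE p need s :
  dom_word p need s = (need ==> head false s) &&
    all (fun i => [|| nth false (p :: s) i, nth false s i | nth false s i.+1])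
        (iota 0 (size s)).
Proof.
elim: s p need => [|b s IHs] p need; first by case: need.
rewrite [LHS]/= IHs /= -[1]addn0 iotaDl all_map nth0; congr (_ && _).
by rewrite implyNb orbA.
Qed.

(** The initial state stands for a virtual vertex before the path, unchosen and already dominated,
    which neither helps nor constrains the first vertex. *)
Lemma dominating_path n (t : n.-tuple bool) :
  @dominating (path_graph n) [set i | tnth t i] = dom_word false false t.
Proof.
rewrite dom_wordE /= size_tuple.
apply/forallP/allP => [dom i | dom v].
  rewrite mem_iota add0n => /= lt_in.
  have /implyP := dom (Ordinal lt_in); rewrite inE (tnth_nth false) /=.
  case: (nth false t i) => /= [_|/(_ isT)/existsP[u]]; first by rewrite orbT.
  rewrite inE (tnth_nth false) /= /path_adj /=.
  case/andP=> tu /orP[] /eqP E; first by rewrite E tu orbT.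
  by rewrite -E /= tu.
apply/implyP; rewrite inE (tnth_nth false) => tv.
have /dom : (v : nat) \in iota 0 n by rewrite mem_iota add0n /=.
rewrite (negbTE tv) /=; case/orP=> tu.
  (* A chosen left neighbour rules out [v = 0], since the virtual vertex is unchosen. *)
  have [i iv] : exists i, (v : nat) = i.+1.
    by case: (v : nat) tu => [//|i] _; exists i.
  have lt_in : i < n by rewrite ltnW // -iv.
  apply/existsP; exists (Ordinal lt_in).
  rewrite inE (tnth_nth false) /= /path_adj /= iv eqxx orbT andbT.
  by rewrite iv in tu.
have lt_vn : v.+1 < n.
  by rewrite ltnNge; apply/negP=> le_nv; rewrite nth_default ?size_tuple in tu.
apply/existsP; exists (Ordinal lt_vn).
by rewrite inE (tnth_nth false) /= /path_adj /= eqxx tu.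
Qed.

Definition dom_count (p need : bool) (n k : nat) : nat :=
  #|[set t : n.-tuple bool | dom_word p need t && (count id t == k)]|.

Lemma card_dominating_path n k :
  card_dominating (path_graph n) k = dom_count false false n k.
Proof.
pose f (t : n.-tuple bool) : {set 'I_n} := [set i | tnth t i].
have inj_f : injective f.
  by move=> t u /setP eq_tu; apply: eq_from_tnth => i; have := eq_tu i; rewrite !inE.
rewrite /dom_count -(card_imset _ inj_f) /card_dominating.
apply: eq_card => /= D; rewrite [LHS]inE.
have Df : D = f [tuple i \in D | i < n].
  by apply/setP=> i; rewrite inE tnth_mktuple.
rewrite [in RHS]Df (mem_imset _ _ inj_f) inE -dominating_path -/(f _) -Df.
by rewrite count_map cardE {1}/enum_mem size_filter -enumT.
Qed.

Lemma card_tuple_cons n (P : pred (seq bool)) :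
  #|[set t : n.+1.-tuple bool | P t]| =
  #|[set t : n.-tuple bool | P (true :: t)]| +
  #|[set t : n.-tuple bool | P (false :: t)]|.
Proof.
rewrite -!sum1dep_card.
rewrite (reindex (fun q : bool * n.-tuple bool => cons_tuple q.1 q.2)) /=.
  by rewrite -(pair_big_dep xpredT (fun b t => P (b :: tval t)) (fun _ _ => 1)) big_bool.
exists (fun t => (thead t, behead_tuple t)) => [[b t]|t] _ /=.
  by congr (_, _); apply: val_inj.
by rewrite [RHS]tuple_eta; apply: val_inj.
Qed.

Lemma dom_count0 p need k : dom_count p need 0 k = ~~ need && (k == 0).
Proof.
rewrite /dom_count (_ : [set t | _] = if ~~ need && (k == 0) then setT else set0).
  by case: ifP; rewrite ?cards0 // cardsT card_tuple.
by apply/setP=> t; rewrite inE tuple0 /= eq_sym; case: ifP; rewrite inE.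
Qed.

Lemma dom_countS p need n k :
  dom_count p need n.+1 k =
    (if k is k'.+1 then dom_count true false n k' else 0) +
    (if need then 0 else dom_count false (~~ p) n k).
Proof.
rewrite /dom_count (card_tuple_cons _ (fun s => dom_word p need s && (count id s == k))).
congr (_ + _).
  case: k => [|k]; last by apply: eq_card => t; rewrite !inE /= implybT orbT.
  by rewrite -[RHS](cards0 {: n.-tuple bool}); apply: eq_card => t; rewrite !inE /= andbF.
case: need => /=; last by apply: eq_card => t; rewrite !inE /= orbF add0n.
by rewrite -[RHS](cards0 {: n.-tuple bool}); apply: eq_card => t; rewrite !inE.
Qed.

(** The three capacity bounds feed one another through the transitions, hence the joint induction.
    The last is written with [n + 1] because [3 * k - 1] would truncate at [k = 0]. *)
Lemma dom_count_eq0 n k :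
  [/\ 3 * k + 1 < n -> dom_count true false n k = 0,
      3 * k < n -> dom_count false false n k = 0
    & 3 * k < n + 1 -> dom_count false true n k = 0].
Proof.
elim: n k => [|n IHn] k; first by split; rewrite ?ltn0 // dom_count0.
have [_ B C] := IHn k; rewrite !dom_countS /=.
case: k B C => [|k] B C; first by split=> ?; rewrite ?B ?C //; lia.
by have [A _ _] := IHn k; split=> ?; rewrite A ?B ?C //; lia.
Qed.

(** Either the first vertex is chosen, or it is skipped and the second is forced. *)
Lemma dom_count_free n k :
  dom_count false false n.+2 k.+1 =
    dom_count true false n.+1 k + dom_count true false n k.
Proof. by rewrite 2!dom_countS /= [in RHS]addnC dom_countS /= addn0 addnC. Qed.

(** The terms correspond to 0, 1 or 2 skipped vertices before the next chosen one. *)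
Lemma dom_count_chosenS n k :
  dom_count true false n.+3 k.+1 =
    dom_count true false n.+2 k + dom_count true false n.+1 k
      + dom_count true false n k.
Proof. by rewrite dom_countS dom_count_free addnA. Qed.

(** Shortfalls 0, 1 and 2 from the capacity [3 * k + 1]; the last is shifted to [k.+1] to avoid a
    negative length, and doubled to avoid division. *)
Lemma dom_count_chosen k :
  [/\ dom_count true false (3 * k).+1 k = 1,
      dom_count true false (3 * k) k = k.+1
    & 2 * dom_count true false (3 * k).+2 k.+1 = k.+1 * k.+4].
Proof.
elim: k => [|k [A0 A1 A2]]; first by rewrite !(dom_countS, dom_count0).
have [F2 _ _] := dom_count_eq0 (3 * k).+2 k.
have [F3 _ _] := dom_count_eq0 (3 * k).+3 k.
have E3 : 3 * k.+1 = (3 * k).+3 by lia.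
have B0 : dom_count true false (3 * k).+4 k.+1 = 1.
  by rewrite dom_count_chosenS A0 F2 ?F3 //; lia.
have B1 : dom_count true false (3 * k).+3 k.+1 = k.+2.
  by rewrite dom_count_chosenS A0 A1 F2 //; lia.
by rewrite E3; split=> //; rewrite dom_count_chosenS B0 B1; lia.
Qed.

(** The first hypothesis says that [k - 1] chosen vertices, covering at most [3 * (k - 1)], are too
    few. *)
Lemma tau_path n k m :
  3 * k < n + 3 -> 0 < m -> dom_count false false n k = m ->
  tau (path_graph n) = m.
Proof.
move=> lt_kn m_gt0 countE; rewrite -countE -card_dominating_path in m_gt0 *.
apply: tau_card_dominating => // j ltjk.
by rewrite card_dominating_path; have [_ -> //] := dom_count_eq0 n j; lia.
Qed.

Theorem theorem5p1 (n : nat) (hn : 2 <= n) :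
  [/\ n = 0 %[mod 3] -> tau (path_graph n) = 1,
      n = 1 %[mod 3] ->
        tau (path_graph n) = n + (n %/ 3 * (n %/ 3 - 1)) %/ 2
    & n = 2 %[mod 3] -> tau (path_graph n) = 2 + n %/ 3].
Proof.
have := divn_eq n 3; set q := n %/ 3 => nE.
split=> nmod; rewrite {}nmod in nE.
- have [k qE] : exists k, q = k.+1 by exists q.-1; lia.
  have {}nE : n = (3 * k).+3 by lia.
  have [A0 _ _] := dom_count_chosen k.
  have gE : dom_count false false n k.+1 = 1.
    by rewrite nE dom_count_free A0; have [-> //] := dom_count_eq0 (3 * k).+2 k; lia.
  by apply: tau_path gE => //; lia.
- have [k qE] : exists k, q = k.+1 by exists q.-1; lia.
  have {}nE : n = (3 * k).+4 by lia.
  have [_ A1 _] := dom_count_chosen k.+1; have [_ _ A2] := dom_count_chosen k.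
  rewrite (_ : 3 * k.+1 = (3 * k).+3) in A1; last by lia.
  (* Choosing the first vertex leaves shortfall 1, skipping it leaves shortfall 2. *)
  have gE : dom_count false false n k.+2 = k.+2 + dom_count true false (3 * k).+2 k.+1.
    by rewrite nE dom_count_free A1.
  rewrite (tau_path _ _ gE) //; last by lia.
  (* Half of [k.+1 * k.+4 = 4 * k.+1 + k.+1 * k]; the linear part together with [k.+2] makes [n]. *)
  suff -> : dom_count true false (3 * k).+2 k.+1 = 2 * k.+1 + (k.+1 * k) %/ 2.
    by rewrite qE subn1 /=; lia.
  by rewrite -divnMDl // -[LHS](mulKn _ (isT : 0 < 2)) A2; congr (_ %/ 2); lia.
- have {}nE : n = (3 * q).+2 by lia.
  have [A0 A1 _] := dom_count_chosen q.
  have gE : dom_count false false n q.+1 = 2 + q by rewrite nE dom_count_free A0 A1.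
  by apply: tau_path gE => //; lia.
Qed.
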